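(* There exist transcendental entire functions $f$ and $g$ and a domain in $\mathbb{C}$ which lies in a periodic component of $F(f)$ and in a wandering component of $F(g)$, and lies in a preperiodic component of $F(g\circ f)$ and in a wandering component of $F(f\circ g)$.
   Context: A domain is a nonempty open connected subset of $\mathbb{C}$. For a transcendental entire function $h$, $h^n$ denotes its $n$-th iterate, and the Fatou set is $F(h)=\{z\in\mathbb{C}: \{h^n\}_{n\in\mathbb{N}} \text{ is normal in some neighborhood of } z\}$. A component of $F(h)$ means a connected component. For a component $U$ of $F(h)$ and $k\ge 0$, let $U_k$ denote the component of $F(h)$ containing $h^k(U)$ (so $U_0=U$). The component $U$ is called wandering if $U_k\cap U_l=\emptyset$ for all $k\neq l$; otherwise it is called preperiodic. It is called periodic if $U_k=U$ for some $k\ge 1$. A domain lies in a wandering (resp. periodic, preperiodic) component of $h$ if it is contained in some wandering (resp. periodic, preperiodic) component of $F(h)$. If $f,g$ are transcendental entire, so are $f\circ g$ and $g\circ f$, and these notions apply to them. *)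

(* Defs.v *)
From HB Require Import structures.
From mathcomp Require Import all_boot all_order all_algebra.
From mathcomp Require Import all_classical all_reals all_analysis.
From mathcomp Require Import complex.
Import numFieldNormedType.Exports.
Import Order.TTheory GRing.Theory Num.Theory.

Set Implicit Arguments.
Unset Strict Implicit.
Unset Printing Implicit Defensive.

Local Open Scope classical_set_scope.
Local Open Scope ring_scope.
Local Open Scope complex_scope.

(* The complex plane is R[i]^o rather than R[i]: the alias carries the topology
   and the structure of normed space over R[i], so that derivable below is
   complex differentiability. *)

Definition entire (R : realType) (f : R[i]^o -> R[i]^o) : Prop :=
  forall z, derivable f z 1.

Definition transcendental_entire (R : realType) (f : R[i]^o -> R[i]^o) : Prop :=
  entire f /\ ~ (exists p : {poly R[i]}, forall z : R[i], f z = p.[z]).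

Definition is_domain (R : realType) (D : set R[i]^o) : Prop :=
  [/\ D !=set0, open D & connected D].

Definition cvg_locally_unif (R : realType) (U : set R[i]^o)
    (u : nat -> R[i]^o -> R[i]^o) (l : R[i]^o -> R[i]^o) : Prop :=
  {family [set K | compact K /\ K `<=` U], u @ \oo --> l}.

Definition cvg_locally_unif_infty (R : realType) (U : set R[i]^o)
    (u : nat -> R[i]^o -> R[i]^o) : Prop :=
  forall K : set R[i]^o, compact K -> K `<=` U ->
  forall M : R, \forall n \near \oo, forall z, K z -> M%:C < `|u n z|.

(* Normality in the sense of Montel, for entire functions: the values of l
   outside U are irrelevant, and l is automatically holomorphic on U. *)
Definition normal_family (R : realType) (U : set R[i]^o)
    (F : set (R[i]^o -> R[i]^o)) : Prop :=
  forall u : nat -> R[i]^o -> R[i]^o, (forall n, F (u n)) ->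
  exists2 phi : nat -> nat, {homo phi : m n / (m < n)%N} &
    (exists l, cvg_locally_unif U (u \o phi) l) \/
    cvg_locally_unif_infty U (u \o phi).

Definition fatou (R : realType) (h : R[i]^o -> R[i]^o) : set R[i]^o :=
  [set z | exists2 U : set R[i]^o, open_nbhs z U &
           normal_family U (range (fun n => iter n h))].

Definition fatou_component (R : realType) (h : R[i]^o -> R[i]^o)
    (U : set R[i]^o) : Prop :=
  exists2 z, fatou h z & U = connected_component (fatou h) z.

(* U_k; there is exactly one such V when U is a component of F(h), h being
   entire and nonconstant, so the default value set0 is never used. *)
Definition component_orbit (R : realType) (h : R[i]^o -> R[i]^o)
    (U : set R[i]^o) (k : nat) : set R[i]^o :=
  xget set0 [set V | fatou_component h V /\ iter k h @` U `<=` V].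

Definition wandering_component (R : realType) (h : R[i]^o -> R[i]^o)
    (U : set R[i]^o) : Prop :=
  fatou_component h U /\
  forall k l : nat, k <> l ->
    component_orbit h U k `&` component_orbit h U l = set0.

Definition preperiodic_component (R : realType) (h : R[i]^o -> R[i]^o)
    (U : set R[i]^o) : Prop :=
  fatou_component h U /\ ~ wandering_component h U.

Definition periodic_component (R : realType) (h : R[i]^o -> R[i]^o)
    (U : set R[i]^o) : Prop :=
  fatou_component h U /\
  exists2 k : nat, (1 <= k)%N & component_orbit h U k = U.

Definition lies_in (R : realType) (D : set R[i]^o)
    (P : set R[i]^o -> Prop) : Prop :=
  exists2 U : set R[i]^o, P U & D `<=` U.

(* Main.v *)
Require Import Defs.
From HB Require Import structures.
From mathcomp Require Import all_boot all_order all_algebra.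
From mathcomp Require Import all_classical all_reals all_analysis.
From mathcomp Require Import complex ring lra.
Import numFieldNormedType.Exports.
Import Order.TTheory GRing.Theory Num.Theory.
Import ComplexField.Normc.
Local Open Scope classical_set_scope.
Local Open Scope ring_scope.
Local Open Scope complex_scope.

Set Implicit Arguments.
Unset Strict Implicit.
Unset Printing Implicit Defensive.

(** The two functions are explicit. Let e be the exponential and consider the
    points s = 2 pi i k, at which e(s) = 1. Then s + 1 - e(s) fixes all of them,
    with derivative 0. Two modifications, flat at these points, give

      g(s) = 2 (s + 1 - e(s)) exp(i s (1 - cosh s)),
      f(s) = s + 1 - e(s) + 2 pi i A(cosh(s / 4)),  A(c) = 1 - 3/2 c^2 + 1/2 c^3,

    so that g(2 pi i k) = 4 pi i k, while f fixes 8 pi i k and exchanges 2 pi i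
    with 4 pi i; all these points are critical. Put s_n = 2^n 4 pi i. Small discs
    D_n about s_n and D' about 2 pi i then satisfy

      f : D_0 -> D' -> D_0,   f : D_n -> D_n (n >= 1),
      g : D_n -> D_(n+1),     g : D' -> D_0.

    Take D = D_0. It is attracted to a 2-cycle of f and to a fixed point of g o f,
    whereas g and f o g both push it along D_0, D_1, D_2, ... to infinity. The
    radii of the D_n have to decrease, since the second derivative of g at s_n
    grows like |s_n|^2; as the first derivative vanishes, radii proportional to
    |s_n|^(-2) are admissible (doubling_contract).

    It remains to see that the D_n lie in distinct components. On the lines
    Im s = (2k+1) pi, with k large, the exponential factor makes |g| at most
    1/24 (doubling_barrier), and the disc of radius 1/24 about 0 is mapped into
    itself by f and by g. So no point of these lines escapes, neither under g nor
    under f o g. On the other hand, escaping is an open and closed condition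
    inside the Fatou set (normal_escaping), so a component that meets some D_n
    consists of escaping points and cannot cross such a line
    (wandering_of_barrier). The same kind of argument shows that the component of
    an attracting periodic point stays in its basin, hence is periodic
    (attracting_periodic_component). *)

(** The theorem of integration theory that bears the same name must not hide the
    Fatou set. *)
Local Notation fatou := Defs.fatou.

(** * The plane with real radii *)

Section Plane.
Variable R : realType.
Local Notation C := R[i]^o.
Local Notation Re := (@complex.Re R).
Local Notation Im := (@complex.Im R).
Implicit Types (z w : C) (e : R) (U : set C).

Lemma normc_ge0 (z : R[i]) : 0 <= normc z.
Proof. by case: z => a b; exact: sqrtr_ge0. Qed.

Lemma normc_gt0 (z : R[i]) : (0 < normc z) = (z != 0).
Proof.
rewrite lt_def normc_ge0 andbT; congr (~~ _); apply/eqP/eqP; first exact: eq0_normc.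
by move=> ->; exact: normc0.
Qed.

Lemma normcB (z w : R[i]) : normc (z - w) = normc (w - z).
Proof. by rewrite -opprB normcN. Qed.

Lemma normc_sub_le0 (z w : R[i]) : normc (z - w) <= 0 -> z = w.
Proof. by move=> h; apply/subr0_eq/eq0_normc/le_anti; rewrite h normc_ge0. Qed.

Lemma ler_normcB (z w : R[i]) : normc z - normc w <= normc (z - w).
Proof. by rewrite lerBlDr -{1}[z](subrK w); exact: le_normcD. Qed.

Lemma le_dist_normcD (x y z : R[i]) : normc (x - z) <= normc (x - y) + normc (y - z).
Proof. by rewrite -[x in x - z](subrK y) -addrA; exact: le_normcD. Qed.

Lemma normc_sqr (z : R[i]) : normc z ^+ 2 = Re z ^+ 2 + Im z ^+ 2.
Proof. by case: z => a b /=; rewrite sqr_sqrtr // addr_ge0 // sqr_ge0. Qed.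

Lemma normc_Re (z : R[i]) : `|Re z| <= normc z.
Proof.
rewrite -ler_sqr ?nnegrE ?normc_ge0 // normc_sqr real_normK ?num_real //.
by rewrite lerDl sqr_ge0.
Qed.

Lemma normc_Im (z : R[i]) : `|Im z| <= normc z.
Proof.
rewrite -ler_sqr ?nnegrE ?normc_ge0 // normc_sqr real_normK ?num_real //.
by rewrite lerDr sqr_ge0.
Qed.

Lemma normc_real (x : R) : normc x%:C = `|x|.
Proof. by rewrite /= expr0n addr0 sqrtr_sqr. Qed.

Lemma normc_im (x : R) : normc (0 +i* x) = `|x|.
Proof. by rewrite /= expr0n add0r sqrtr_sqr. Qed.

Lemma normc_nat n : normc (n%:R : R[i]) = n%:R.
Proof. by rewrite -(normr_nat R n) -normc_real rmorph_nat. Qed.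

Lemma normc_le_ReIm (z : R[i]) : normc z <= `|Re z| + `|Im z|.
Proof.
rewrite [z in leLHS]complexE; apply: le_trans (le_normcD _ _) _.
by rewrite normcM normc_im normr1 mul1r !normc_real.
Qed.

(** The norm of the plane takes its values in the plane itself, so the radii of
    its balls are complex; this rephrases neighbourhoods with real radii. *)
Lemma nbhs_normcP z (P : set C) :
  nbhs z P <-> exists2 e, 0 < e & forall w, normc (w - z) < e -> P w.
Proof.
split=> [/nbhs_ballP[[a b] /= ab0 sub]|[e e0 sub]].
  move: ab0; rewrite ltcE /= => /andP[/eqP b0 a0].
  exists a => // w wz; apply: sub.
  rewrite -ball_normE /= b0 -[_ < _]/(_ < a%:C).
  by rewrite -[`|_|]/((normc (z - w))%:C) ltcR normcB.
apply/nbhs_ballP; exists e%:C => /=; first by rewrite ltcR.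
move=> w; rewrite -ball_normE /= -[`|_|]/((normc (z - w))%:C) ltcR normcB; exact: sub.
Qed.

Lemma continuous_normc (h : C -> C) z e : continuous h -> 0 < e ->
  exists2 d, 0 < d & forall w, normc (w - z) < d -> normc (h w - h z) < e.
Proof.
move=> /(_ z) hz e0; apply/(nbhs_normcP z [set w | normc (h w - h z) < e]).
by apply: (hz [set v | normc (v - h z) < e]); apply/nbhs_normcP; exists e.
Qed.

Lemma continuous_Im : continuous (Im : C -> R).
Proof.
move=> z P /nbhs_ballP[e /= e0 sub]; apply/nbhs_normcP; exists e => // w wz.
apply: sub; rewrite -ball_normE /= distrC; apply: le_lt_trans wz.
by rewrite (le_trans _ (normc_Im _)) //; case: (w) (z) => [a b] [c d].
Qed.

Lemma continuous_iter (h : C -> C) n : continuous h -> continuous (iter n h).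
Proof.
move=> ch; elim: n => [|n IHn] z; first exact: cvg_id.
exact: continuous_comp (IHn z) (ch _).
Qed.

Lemma cvg_locally_unifP U (u : nat -> C -> C) l : cvg_locally_unif U u l <->
  forall K, compact K -> K `<=` U -> forall e, 0 < e ->
    \forall n \near \oo, forall z, K z -> normc (u n z - l z) < e.
Proof.
split=> [cul K cK KU e e0|H].
  move/fam_cvgP : cul => /(_ K (conj cK KU)) /(_ [set h : C -> C |
     forall z, K z -> normc (h z - l z) < e]); apply.
  apply/uniform_nbhs; exists [set xy : C * C | ball xy.1 e%:C xy.2]; split.
    by rewrite -entourage_ballE; exists e%:C => //=; rewrite ltcR.
  move=> h hl z Kz; move: (hl z Kz) => /=.
  by rewrite -ball_normE /= -[`|_|]/((normc (l z - h z))%:C) ltcR normcB.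
apply/fam_cvgP => K [cK KU] P /uniform_nbhs[E [entE subP]].
move: entE; rewrite -entourage_ballE => -[[a b] /= ab0 subE].
move: ab0; rewrite ltcE /= => /andP[/eqP b0 a0].
have := H K cK KU a a0; apply: filterS => n hn; apply: subP => z Kz.
apply: subE => /=; rewrite -ball_normE /= b0 -[_ < _]/(_ < a%:C).
by rewrite -[`|_|]/((normc (l z - u n z))%:C) ltcR normcB; exact: hn.
Qed.

(** Local compactness of the plane, through compact rectangles. *)
Lemma closed_box_nbhs z (U : set C) : nbhs z U ->
  exists2 K : set C, compact K & nbhs z K /\ K `<=` U.
Proof.
move=> /nbhs_normcP[e e0 sub].
pose F (p : R * R) : C := (p.1 +i* p.2).
have leF (p q : R * R) : normc (F p - F q) <= `|p.1 - q.1| + `|p.2 - q.2|.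
  by apply: le_trans (normc_le_ReIm _) _; rewrite /F; simpc.
have cF : continuous F.
  move=> p P /nbhs_normcP[d d0 subd].
  have d20 : 0 < d / 2 by rewrite divr_gt0.
  exists (ball p.1 (d / 2), ball p.2 (d / 2)).
    by split; apply: nbhsx_ballx.
  move=> q [/= q1 q2]; apply: subd; apply: le_lt_trans (leF _ _) _.
  rewrite -ball_normE /= in q1 q2.
  by rewrite [d]splitr ltrD // distrC.
set K0 := `[Re z - e / 3, Re z + e / 3]%classic `*` `[Im z - e / 3, Im z + e / 3]%classic.
have zF : z = F (Re z, Im z) by case: z {sub} @K0.
exists (F @` K0).
  apply: continuous_compact; first exact: continuous_subspaceT.
  by apply: compact_setX; exact: segment_compact.
split.
  apply/nbhs_normcP; exists (e / 3); first by lra.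
  move=> w wz; exists (Re w, Im w); last by case: w {wz}.
  have Rew : `|Re w - Re z| < e / 3.
    by apply: le_lt_trans wz; move: (normc_Re (w - z)); case: (w) (z) => [a b] [c d].
  have Imw : `|Im w - Im z| < e / 3.
    by apply: le_lt_trans wz; move: (normc_Im (w - z)); case: (w) (z) => [a b] [c d].
  move: Rew Imw; rewrite !ltr_norml => /andP[a1 a2] /andP[b1 b2].
  by split=> /=; rewrite in_itv /=; apply/andP; split; lra.
move=> _ [[a b] [/= + +] <-]; rewrite !in_itv /= => /andP[a1 a2] /andP[b1 b2].
apply: sub; rewrite [X in _ - X]zF; apply: le_lt_trans (leF _ _) _ => /=.
have : `|a - Re z| <= e / 3 by rewrite ler_norml; apply/andP; split; lra.
have : `|b - Im z| <= e / 3 by rewrite ler_norml; apply/andP; split; lra.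
lra.
Qed.

(** A property that is locally constant along a connected set spreads over it:
    within the set, its locus is both open and closed. *)
Lemma connected_locally_constant (T : topologicalType) (V : set T) (P : set T) :
  connected V -> (forall x, V x -> \forall y \near x, P y <-> P x) ->
  forall a b, V a -> V b -> P a -> P b.
Proof.
move=> cV lc a b Va Vb Pa.
suff : V `&` P = V by move=> VP; move: Vb; rewrite -VP => -[].
apply: cV; first by exists a.
  exists (P°); first exact: open_interior.
  apply/seteqP; split=> x [Vx Px]; split => //; last exact: interior_subset Px.
  have := lc x Vx; rewrite /interior /=; apply: filterS => y; tauto.
exists (~` (~` P)°); first exact/open_closedC/open_interior.
apply/seteqP; split=> x [Vx Px]; split => //.
  by move=> /interior_subset.
apply: contrapT => nPx; apply: Px.
by have := lc x Vx; rewrite /interior /=; apply: filterS => y [Pxy _] /Pxy /nPx.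
Qed.

Definition disc z (r : R) : set C := [set w | normc (w - z) < r].

Lemma disc_open z r : open (disc z r).
Proof.
rewrite openE => w wz; apply/nbhs_normcP; exists (r - normc (w - z)).
  by rewrite subr_gt0.
by move=> v vw; have := le_dist_normcD v w z; rewrite /disc /=; lra.
Qed.

Lemma disc_center z r : 0 < r -> disc z r z.
Proof. by move=> r0; rewrite /disc /= subrr normc0. Qed.

(** A disc is the union of the segments that join its centre to its points. *)
Lemma disc_connected z r : 0 < r -> connected (disc z r).
Proof.
move=> r0.
pose seg (w : C) (t : R) : C := z + t%:C * (w - z).
have segE (w : C) (t u : R) : normc (seg w t - seg w u) = `|t - u| * normc (w - z).
  rewrite -normc_real -normcM; congr normc; rewrite /seg rmorphB /=; ring.
have cseg (w : C) : continuous (seg w).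
  move=> t P /nbhs_normcP[e e0 sub].
  have n0 := normc_ge0 (w - z).
  apply/nbhs_ballP; exists (e / (normc (w - z) + 1)) => /=.
    by apply: divr_gt0 => //; lra.
  move=> u; rewrite -ball_normE /= distrC ltr_pdivlMr; last by lra.
  move=> ut; apply: sub; rewrite segE; have := normr_ge0 (u - t); nra.
have -> : disc z r = \bigcup_(w in disc z r) (seg w @` `[0, 1]%classic).
  apply/seteqP; split=> [w wz|_ [w wz [t]] /= + <-].
    exists w => //; exists 1; first by rewrite /= in_itv /= ler01 lexx.
    by rewrite /seg mul1r addrC subrK.
  rewrite in_itv /= => /andP[t0 t1]; rewrite /disc /=.
  have -> : z = seg w 0 by rewrite /seg mul0r addr0.
  rewrite segE subr0 ger0_norm //; move: wz; rewrite /disc /=.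
  have := normc_ge0 (w - z); nra.
apply: bigcup_connected.
  exists z => w wz; exists 0; first by rewrite /= in_itv /= lexx ler01.
  by rewrite /seg mul0r addr0.
move=> w wz; apply: connected_continuous_connected.
  by apply/connected_intervalP; exact: interval_is_interval.
exact: continuous_subspaceT.
Qed.

End Plane.

(** * Normality and escaping points *)

Section Dynamics.
Variable R : realType.
Local Notation C := R[i]^o.
Local Notation Re := (@complex.Re R).
Local Notation Im := (@complex.Im R).
Implicit Types (z w : C) (e : R) (h : C -> C).

Lemma extraction (P : nat -> Prop) : (forall N, exists j, (N <= j)%N /\ P j) ->
  exists2 phi : nat -> nat, {homo phi : m n / (m < n)%N} & forall j, P (phi j).
Proof.
move=> /choice[f Pf].
pose phi := fix phi n := if n is m.+1 then f (phi m).+1 else f 0%N.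
exists phi => [|[|j] /=]; [|exact: (Pf _).2 ..].
by apply: homo_ltn => [|n /=]; [exact: ltn_trans|exact: (Pf _).1].
Qed.

Lemma homo_ltn_ge_id (phi : nat -> nat) :
  {homo phi : m n / (m < n)%N} -> forall n, (n <= phi n)%N.
Proof.
by move=> hphi; elim=> // n IHn; apply: leq_ltn_trans IHn _; exact: hphi.
Qed.

(** To prove that iterates form a normal family it is enough to extract from
    sequences of iterates whose exponents tend to infinity: any other sequence
    repeats one and the same iterate infinitely often. *)
Lemma normal_rangeP h (U : set C) :
  (forall m : nat -> nat, (forall N, \forall j \near \oo, (N <= m j)%N) ->
    exists2 phi : nat -> nat, {homo phi : m n / (m < n)%N} &
      (exists l, cvg_locally_unif U (fun j => iter (m (phi j)) h) l) \/
      cvg_locally_unif_infty U (fun j => iter (m (phi j)) h)) ->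
  normal_family U (range (fun n => iter n h)).
Proof.
move=> H u uh.
have /choice[m mu] n : exists m, u n = iter m h by have [m _ <-] := uh n; exists m.
have [[v vm]|nvm] := pselect (exists v, forall N, exists j, (N <= j)%N /\ m j = v).
  have [phi hphi phiv] := extraction vm; exists phi => //; left; exists (iter v h).
  apply/cvg_locally_unifP => K cK KU e e0; near=> n => z Kz /=.
  by rewrite mu phiv subrr normc0.
have [N|phi hphi Hphi] := H m.
  elim: N => [|N IHN]; first by near=> j.
  have [N' N'P] : exists N', forall j, (N' <= j)%N -> m j <> N.
    apply: contrapT => /forallNP H'; apply: nvm; exists N => N'.
    apply: contrapT => /forallNP H''; apply: (H' N') => j N'j mj.
    exact: (H'' j).
  have : \forall j \near \oo, m j <> N by exists N' => // j; exact: N'P.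
  by apply: filterS2 IHN => j Nj /eqP jN; rewrite ltn_neqAle eq_sym jN.
exists phi => //; suff -> : u \o phi = (fun j => iter (m (phi j)) h) by [].
by apply/funext => j /=; rewrite mu.
Unshelve. all: by end_near. Qed.

Definition escaping h z :=
  forall M : R, \forall n \near \oo, M < normc (iter n h z).

Lemma escaping_iter h z k : escaping h z -> escaping h (iter k h z).
Proof.
move=> ez M; have [N _ HN] := ez M; exists N => // n Nn.
by rewrite -iterD; apply: HN => /=; rewrite (leq_trans Nn) // leq_addr.
Qed.

Lemma uniform_escaping_normal h (U : set C) :
  (forall M : R, \forall n \near \oo, forall w, U w -> M < normc (iter n h w)) ->
  normal_family U (range (fun n => iter n h)).
Proof.
move=> H; apply: normal_rangeP => m moo; exists id => //; right => K cK KU M.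
have [N _ HN] := H M; apply: filterS (moo N) => j Nmj z Kz.
rewrite -[`|_|]/((normc (iter (m j) h z))%:C) ltcR.
by apply: HN; [exact: Nmj|exact: KU].
Qed.

(** On the Fatou set escaping to infinity is a local property: if b did not
    escape, some iterates would stay bounded at b, and a subsequence of them,
    being normal, could not tend to infinity at a either. *)
Lemma normal_escaping h (U : set C) a b :
  normal_family U (range (fun n => iter n h)) -> U a -> U b ->
  escaping h a -> escaping h b.
Proof.
move=> nU Ua Ub ea; apply: contrapT => /existsNP[M neb].
have /extraction[psi hpsi psiP] N : exists j, (N <= j)%N /\ normc (iter j h b) <= M.
  apply: contrapT => /forallNP HN; apply: neb; exists N => // n /= Nn.
  by rewrite ltNge; apply/negP => nM; apply: (HN n).
have [|phi hphi [[l cul]|cu]] := nU (fun j => iter (psi j) h).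
- by move=> n; exists (psi n).
- have a1 : [set a] `<=` U by move=> _ ->.
  have [N1 _ H1] := (cvg_locally_unifP _ _ _).1 cul _ (@compact_set1 _ a) a1 1 ltr01.
  have [N2 _ H2] := ea (normc (l a) + 1).
  pose n := maxn N1 N2.
  have := H1 n (leq_maxl _ _) a erefl; rewrite /=.
  have : (N2 <= psi (phi n))%N.
    apply: leq_trans (homo_ltn_ge_id hpsi _).
    by apply: leq_trans (homo_ltn_ge_id hphi _); exact: leq_maxr.
  move=> /H2 /=; have := ler_normcB (iter (psi (phi n)) h a) (l a); lra.
- have b1 : [set b] `<=` U by move=> _ ->.
  have [N _ HN] := cu _ (@compact_set1 _ b) b1 M.
  have := HN N (leqnn _) b erefl.
  rewrite -[`|_|]/((normc (iter (psi (phi N)) h b))%:C) ltcR ltNge.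
  by rewrite psiP.
Qed.

Lemma fatou_escaping_locally_constant h z : fatou h z ->
  \forall w \near z, escaping h w <-> escaping h z.
Proof.
move=> [U [oU Uz] nU]; have := open_nbhs_nbhs (conj oU Uz).
by apply: filterS => w Uw; split; apply: normal_escaping nU _ _.
Qed.

Lemma fatou_component_eq h V W x :
  fatou_component h V -> fatou_component h W -> V x -> W x -> V = W.
Proof.
by move=> [a _ ->] [b _ ->] /same_connected_component -> /same_connected_component ->.
Qed.

Lemma component_orbit_eq h U V k : U !=set0 -> fatou_component h V ->
  iter k h @` U `<=` V -> component_orbit h U k = V.
Proof.
move=> [x Ux] cV UV; apply: xget_unique => // W [cW UW].
apply: (fatou_component_eq cW cV (x := iter k h x)).
  by apply: UW; exists x.
by apply: UV; exists x.
Qed.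

Lemma mem_component_orbit h U k x : component_orbit h U k x ->
  fatou_component h (component_orbit h U k) /\
  iter k h @` U `<=` component_orbit h U k.
Proof. by rewrite /component_orbit; case: xgetP => // V _ []. Qed.

Lemma fatou_component_nonempty h U : fatou_component h U -> U !=set0.
Proof. by move=> [z Fz ->]; exists z; exact: connected_component_refl. Qed.

Lemma periodic_preperiodic h U : periodic_component h U -> preperiodic_component h U.
Proof.
move=> [cU [k k0 Uk]]; split => // -[_ /(_ 0%N k)].
have U0 := fatou_component_nonempty cU.
have -> : component_orbit h U 0 = U.
  by apply: component_orbit_eq => // _ [x Ux <-].
rewrite Uk setIid => H; have : 0%N <> k by case: k k0 {Uk H}.
by move=> /H U00; case: U0; rewrite U00.
Qed.

(** Points whose orbit does not escape separate escaping Fatou components: a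
    component that met two members of the orbit of p would cross a horizontal
    line on which nothing escapes, although all of its points escape as soon as
    one of them does. *)
Lemma wandering_of_barrier h p (cut : nat -> R) :
  fatou h p -> escaping h p ->
  (forall k, Im (iter k h p) < cut k < Im (iter k.+1 h p)) ->
  (forall k z, Im z = cut k -> ~ escaping h z) ->
  wandering_component h (connected_component (fatou h) p).
Proof.
move=> Fp ep cutP cutN; set U := connected_component _ _.
have cU : fatou_component h U by exists p.
have Up : U p by exact: connected_component_refl.
split => //.
suff main k l : (k < l)%N -> component_orbit h U k `&` component_orbit h U l = set0.
  by move=> k l /eqP; rewrite neq_ltn => /orP[|] /main //; rewrite setIC.
move=> kl; rewrite -subset0 => x [xk xl].
have [ck sk] := mem_component_orbit xk; have [cl sl] := mem_component_orbit xl.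
have kVl := fatou_component_eq ck cl xk xl.
set V := component_orbit h U k in ck sk kVl xk.
have Vk : V (iter k h p) by apply: sk; exists p.
have Vl : V (iter l h p) by rewrite kVl; apply: sl; exists p.
have Im_lt : forall n, Im (iter k.+1 h p) <= Im (iter (n + k.+1) h p).
  elim=> // n /le_trans; apply; have /andP[a b] := cutP (n + k.+1)%N.
  by apply: ltW; apply: lt_trans a b.
have cV : connected V by case: ck => z _ ->; exact: component_connected.
have VF : V `<=` fatou h by case: ck => z _ ->; exact: connected_component_sub.
have /connected_intervalP iV : connected [set Im z | z in V].
  apply: connected_continuous_connected cV _.
  exact/continuous_subspaceT/continuous_Im.
have [w Vw wk] : [set Im z | z in V] (cut k).
  apply: (iV (Im (iter k h p)) (Im (iter l h p))); [by exists (iter k h p)|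
    by exists (iter l h p)|].
  have /andP[a b] := cutP k; rewrite (ltW a) (le_trans (ltW b)) //.
  by rewrite -(subnK kl).
apply: (cutN k w wk).
apply: (connected_locally_constant cV _ Vk Vw (escaping_iter k ep)).
by move=> z Vz; exact/fatou_escaping_locally_constant/VF.
Qed.

End Dynamics.

(** * Basins of attracting cycles *)

Section Basin.
Variable R : realType.
Local Notation C := R[i]^o.
Variables (h : C -> C) (q : nat) (p : C) (r : R).
Hypotheses (ch : continuous h) (q0 : (0 < q)%N) (r0 : 0 < r) (hp : iter q h p = p).
Hypothesis contr :
  forall w, normc (w - p) < r -> normc (iter q h w - p) <= normc (w - p) / 2.

Definition basin : set C := [set z | exists n, normc (iter (n * q) h z - p) < r].

Lemma contraction_iter w n : normc (w - p) < r ->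
  normc (iter (n * q) h w - p) <= normc (w - p) / 2 ^+ n.
Proof.
move=> wr; elim: n => [|n IHn]; first by rewrite expr0 divr1.
have wn : normc (w - p) / 2 ^+ n < r.
  apply: le_lt_trans wr; rewrite ler_pdivrMr ?exprn_gt0 // ler_peMr ?normc_ge0 //.
  by rewrite exprn_ege1 // ler1n.
rewrite mulSn iterD; apply: le_trans (contr (le_lt_trans IHn wn)) _.
by rewrite exprSr invfM mulrA ler_pM2r ?invr_gt0.
Qed.

Lemma uniform_contraction (e : R) : 0 < e ->
  exists k, forall n w, (k <= n)%N -> normc (w - p) < r ->
    normc (iter (n * q) h w - p) < e.
Proof.
move=> e0; pose k := (Num.truncn (r / e)).+1; exists k => n w kn wr.
have rk : r / e < k%:R by exact: truncnS_gt.
have k2 : k%:R <= 2 ^+ n :> R.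
  by rewrite -natrX ler_nat (leq_trans kn) // ltnW // ltn_expl.
apply: le_lt_trans (contraction_iter n wr) _.
rewrite ltr_pdivrMr ?exprn_gt0 //; apply: lt_le_trans wr _.
by rewrite mulrC -ler_pdivrMr // (le_trans (ltW rk)).
Qed.

Lemma basin_cvg w (e : R) : basin w -> 0 < e ->
  \forall n \near \oo, normc (iter (n * q) h w - p) < e.
Proof.
move=> [n0 wn0] /uniform_contraction[k ke]; exists (n0 + k)%N => // n /= n0kn.
have n0n : (n0 <= n)%N by apply: leq_trans n0kn; rewrite leq_addr.
by rewrite -(subnK n0n) mulnDl iterD; apply: ke => //; rewrite leq_subRL.
Qed.

Lemma basin_open z n : normc (iter (n * q) h z - p) < r ->
  \forall w \near z, normc (iter (n * q) h w - p) < r.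
Proof.
set e := normc _; move=> er.
have [|d d0 dP] := continuous_normc z (continuous_iter (n := n * q) ch) (e := r - e).
  by rewrite subr_gt0.
apply/nbhs_normcP; exists d => // w /dP.
by have := le_dist_normcD (iter (n * q) h w) (iter (n * q) h z) p; rewrite -/e; lra.
Qed.

(** Near a point of the basin, the iterates whose exponents are congruent to s
    modulo q converge uniformly to the s-th point of the cycle; a sequence of
    exponents keeps one residue s along a subsequence. *)
Lemma basin_fatou z : basin z -> fatou h z.
Proof.
move=> [n0 zn0]; exists [set w : C | normc (iter (n0 * q) h w - p) < r].
  split=> //; rewrite openE => w /=; exact: basin_open.
apply: normal_rangeP => m moo.
have [s sP] : exists s : 'I_q, forall N, exists j, (N <= j)%N /\ (m j %% q)%N = s.
  apply: contrapT => /forallNP H.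
  have : \forall j \near \oo, forall s : 'I_q, (m j %% q)%N <> s.
    apply: filter_forall => s; have /existsNP[N HN] := H s; exists N => // j /= Nj.
    by move=> js; apply: HN; exists j.
  move=> [N _ HN]; exact: (HN N (leqnn N) (Ordinal (ltn_pmod (m N) q0))).
have [phi hphi phiP] := extraction sP; exists phi => //; left; exists (cst (iter s h p)).
apply/cvg_locally_unifP => K cK KU e e0.
have [d d0 dP] := continuous_normc p (continuous_iter (n := s) ch) e0.
have [k kd] := uniform_contraction d0.
have [N _ HN] := moo ((n0 + k).+1 * q)%N; exists N => // j /= Nj w /KU /= wU.
have := HN _ (leq_trans Nj (homo_ltn_ge_id hphi j)); rewrite /= => mj.
rewrite (divn_eq (m (phi j)) q) phiP addnC iterD; apply: dP.
have n0k : (n0 + k <= m (phi j) %/ q)%N.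
  by rewrite leq_divRL // (leq_trans _ mj) // leq_mul2r leqnSn orbT.
have n0n : (n0 <= m (phi j) %/ q)%N by apply: leq_trans n0k; rewrite leq_addr.
by rewrite -(subnK n0n) mulnDl iterD; apply: kd => //; rewrite leq_subRL.
Qed.

(** Let u be a subsequence of the q-th iterates that converges uniformly to l on
    a compact box about z. Since l = p at the basin points of the box, one and
    the same term of u sends all of them close to p, hence sends their limit z
    into the trapping disc. *)
Lemma fatou_basin_closed z : fatou h z ->
  (forall U, nbhs z U -> exists2 w, U w & basin w) -> basin z.
Proof.
move=> [U oU nU] zbasin.
have [K cK [nK KU]] := closed_box_nbhs (open_nbhs_nbhs oU).
have [|phi hphi [[l cul]|cu]] := nU (fun n => iter (n * q) h).
- by move=> n; exists (n * q)%N.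
- have r4 : 0 < r / 4 by rewrite divr_gt0.
  have [N _ HN] := (cvg_locally_unifP _ _ _).1 cul K cK KU (r / 4) r4.
  have lp w : K w -> basin w -> normc (l w - p) < r / 2.
    move=> Kw bw; have [N' _ HN'] := basin_cvg bw r4.
    have := HN (maxn N N') (leq_maxl _ _) w Kw; rewrite /= normcB => lw.
    have /HN' /= := leq_trans (leq_maxr N N') (homo_ltn_ge_id hphi _).
    have := le_dist_normcD (l w) (iter (phi (maxn N N') * q) h w) p; lra.
  have [d d0 dP] := continuous_normc z (continuous_iter (n := phi N * q) ch) r4.
  have nd : nbhs z [set w | normc (w - z) < d] by apply/nbhs_normcP; exists d.
  have [w [Kw /= /dP wz] bw] := zbasin _ (filterI nK nd).
  exists (phi N); have := HN N (leqnn _) w Kw; have := lp w Kw bw; rewrite /= in wz *.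
  have := le_dist_normcD (iter (phi N * q) h z) (iter (phi N * q) h w) p.
  have := le_dist_normcD (iter (phi N * q) h w) (l w) p.
  rewrite normcB in wz; lra.
- have [w Kw bw] := zbasin K nK.
  have [N _ HN] := basin_cvg bw ltr01.
  have [N' _ HN'] := cu K cK KU (normc p + 1).
  have := HN' (maxn N N') (leq_maxr _ _) w Kw.
  rewrite -[`|_|]/((normc (iter (phi (maxn N N') * q) h w))%:C) ltcR.
  have /HN /= := leq_trans (leq_maxl N N') (homo_ltn_ge_id hphi _).
  have := ler_normcB (iter (phi (maxn N N') * q) h w) p; lra.
Qed.

(** The basin is open, and closed in the Fatou set. *)
Lemma basin_component : connected_component (fatou h) p `<=` basin.
Proof.
move=> z Uz; have bp : basin p by exists 0%N; rewrite /= subrr normc0.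
apply: (connected_locally_constant (@component_connected _ (fatou h) p) _ _ Uz bp).
  move=> x /connected_component_sub Fx; have [bx|nbx] := pselect (basin x).
    have [n xn] := bx; have := basin_open xn; apply: filterS => w wn.
    by split=> // _; exists n.
  apply: contrapT => H; apply: (nbx); apply: fatou_basin_closed => // U nU.
  apply: contrapT => /forall2NP HU; apply: H; apply: filterS nU => w Uw.
  by case: (HU w) => // nbw; split=> // /nbx.
by apply: connected_component_refl; exact: basin_fatou.
Qed.

Lemma attracting_periodic_component :
  periodic_component h (connected_component (fatou h) p).
Proof.
have bp : basin p by exists 0%N; rewrite /= subrr normc0.
have Fp := basin_fatou bp; have pp := connected_component_refl Fp.
have cU : fatou_component h (connected_component (fatou h) p) by exists p.
split=> //; exists q => //; apply: component_orbit_eq => //; first by exists p.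
apply: connected_component_max.
- by exists p.
- move=> _ [w /basin_component [n wn] <-]; apply: basin_fatou; exists n.
  rewrite -iterD addnC iterD; apply: le_lt_trans (contr wn) _.
  by have := normc_ge0 (iter (n * q) h w - p); lra.
- apply: connected_continuous_connected; first exact: component_connected.
  by apply: continuous_subspaceT; exact: continuous_iter.
Qed.

End Basin.

(** * The complex exponential *)

Section RealBounds.
Variable R : realType.
Implicit Types x y : R.

Lemma norm_sin_le y : `|sin y| <= `|y|.
Proof.
wlog y0 : y / 0 < y.
  move=> H; have [/H //|y0|<-] := ltgtP 0 y; last by rewrite sin0 normr0.
  by rewrite -normrN -sinN -[leRHS]normrN; apply: H; rewrite oppr_gt0.
have csin : {within `[0, y], continuous (@sin R)}.
  by apply: continuous_subspaceT; exact: continuous_sin.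
have [c _] := MVT y0 (fun x _ => is_derive_sin x) csin.
by rewrite sin0 !subr0 => ->; rewrite normrM ler_piMl // cos_max.
Qed.

Lemma cos_bounds y : 0 <= 1 - cos y <= y ^+ 2 / 2.
Proof.
have -> : y = (y / 2) *+ 2 by lra.
rewrite cos_mulr2n cos2sin2.
have := norm_sin_le (y / 2); rewrite -ler_sqr ?nnegrE // !real_normK ?num_real // => h.
have := sqr_ge0 (sin (y / 2)); set s := sin _ ^+ 2 in h *; move=> s0.
by apply/andP; split; nra.
Qed.

Lemma norm_sin_sub_le y : `|y| <= 1 -> `|sin y - y| <= y ^+ 2 / 2.
Proof.
wlog y0 : y / 0 < y.
  move=> H; have [/H //|y0|<-] := ltgtP 0 y; last first.
    by rewrite sin0 subr0 normr0 expr0n /= mul0r.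
  move=> y1; have := H (- y); rewrite oppr_gt0 normrN sqrrN sinN => /(_ y0 y1).
  by rewrite -opprD normrN.
rewrite gtr0_norm // => y1.
have csin : {within `[0, y], continuous (fun x : R => sin x - x)}.
  apply: continuous_subspaceT => x.
  by apply: cvgB; [exact: continuous_sin|exact: cvg_id].
have dsin (x : R) : is_derive x 1 (fun x : R => sin x - x) (cos x - 1).
  exact: is_deriveB.
have [c] := MVT y0 (fun x _ => dsin x) csin.
rewrite in_itv /= => /andP[c0 cy].
rewrite sin0 !subr0 => ->; rewrite normrM (gtr0_norm y0) distrC.
have /andP[a b] := cos_bounds c; rewrite (ger0_norm a).
have : c ^+ 2 / 2 <= y / 2 by nra.
nra.
Qed.

(** The upper bound comes from exp(-x) >= 1 - x, that is exp x <= 1/(1 - x). *)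
Lemma expR_sub_bounds x : `|x| <= 1 / 2 -> 0 <= expR x - 1 - x <= 2 * x ^+ 2.
Proof.
rewrite ler_norml => /andP[a b]; have e1 := expR_ge1Dx x.
have e2 := expR_ge1Dx (- x); have e3 := expRxMexpNx_1 x.
have e4 := expR_gt0 x.
have e5 : expR x * (1 - x) <= 1 by rewrite -e3 ler_pM2l //; lra.
apply/andP; split; first lra.
have : expR x * (1 - x) <= (1 + x + 2 * x ^+ 2) * (1 - x) by nra.
rewrite ler_pM2r; lra.
Qed.

End RealBounds.

Section ComplexExponential.
Variable R : realType.
Local Notation C := R[i]^o.
Local Notation Re := (@complex.Re R).
Local Notation Im := (@complex.Im R).
Implicit Types z w : R[i].

Definition cexp (z : C) : C :=
  (expR (Re z) * cos (Im z)) +i* (expR (Re z) * sin (Im z)).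

Lemma cexp0 : cexp 0 = 1.
Proof. by rewrite /cexp /= expR0 cos0 sin0 mulr1 mulr0. Qed.

Lemma cexpD z w : cexp (z + w) = cexp z * cexp w.
Proof.
case: z w => [a b] [c d]; rewrite /cexp /= expRD cosD sinD; simpc.
by congr (_ +i* _); ring.
Qed.

Lemma cexpN z : cexp (- z) = (cexp z)^-1.
Proof.
have h : cexp z * cexp (- z) = 1 by rewrite -cexpD subrr cexp0.
have nz : cexp z != 0 by apply: contra_eq_neq h => ->; rewrite mul0r eq_sym oner_neq0.
by apply: (mulfI nz); rewrite h mulfV.
Qed.

Lemma normc_cexp z : normc (cexp z) = expR (Re z).
Proof.
rewrite /cexp /= !exprMn -mulrDr cos2Dsin2 mulr1 sqrtr_sqr.
by rewrite gtr0_norm // expR_gt0.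
Qed.

(** All later estimates are of second order and rest on this one. *)
Lemma cexp_remainder z : normc z <= 1 / 2 ->
  normc (cexp z - 1 - z) <= 3 * normc z ^+ 2.
Proof.
move=> z12; have x12 := le_trans (normc_Re z) z12.
have y12 := le_trans (normc_Im z) z12.
apply: le_trans (normc_le_ReIm _) _; rewrite normc_sqr.
case: z {z12} x12 y12 => x y /= x12 y12; rewrite oppr0 addr0.
have /andP[e1 e2] := expR_sub_bounds x12.
have /andP[c1 c2] := cos_bounds y.
have s1 := norm_sin_le y.
have s2 : `|sin y - y| <= y ^+ 2 / 2 by apply: norm_sin_sub_le; lra.
have e0 := expR_gt0 x.
have xn : x ^+ 2 = `|x| ^+ 2 by rewrite real_normK ?num_real.
have yn : y ^+ 2 = `|y| ^+ 2 by rewrite real_normK ?num_real.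
have x0 := normr_ge0 x; have y0 := normr_ge0 y.
have [x3 x4] : - `|x| <= x /\ x <= `|x|.
  by have := lexx `|x|; rewrite {1}ler_norml => /andP[].
have e3 : expR x <= 2 by nra.
have e4 : `|expR x - 1| <= 2 * `|x| by rewrite ler_norml; apply/andP; split; nra.
have -> : expR x * cos y - 1 - x = (expR x - 1 - x) - expR x * (1 - cos y) by ring.
have -> : expR x * sin y - y = (expR x - 1) * sin y + (sin y - y) by ring.
have A : `|(expR x - 1 - x) - expR x * (1 - cos y)| <= 2 * x ^+ 2 + y ^+ 2.
  by rewrite ler_norml; apply/andP; split; nra.
have B : `|(expR x - 1) * sin y| <= 2 * `|x| * `|y|.
  by rewrite normrM; apply: ler_pM.
have := ler_normD ((expR x - 1) * sin y) (sin y - y).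
have := sqr_ge0 (`|x| - `|y|); nra.
Qed.

Lemma entire_cexp : entire cexp.
Proof.
move=> z; apply/cvg_ex; exists (cexp z : C) => P /nbhs_normcP[e e0 sub].
pose d : R := Num.min (1 / 2) (e / (3 * normc (cexp z) + 1)).
have c0 := normc_ge0 (cexp z).
have d0 : 0 < d by rewrite lt_min; apply/andP; split; [lra|apply: divr_gt0 => //; lra].
apply/(nbhs_normcP (0 : C)); exists d => // w; rewrite subr0 lt_min => /andP[w1 w2] w0.
apply: sub; rewrite /= /GRing.scale /= mulr1 cexpD.
have nw0 : 0 < normc w by rewrite normc_gt0.
have -> : w^-1 * (cexp w * cexp z - cexp z) - cexp z
   = cexp z * (w^-1 * (cexp w - 1 - w)).
  by field.
rewrite !normcM normcV.
have := cexp_remainder (ltW w1) => rem.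
have : (normc w)^-1 * normc (cexp w - 1 - w) <= 3 * normc w.
  by rewrite mulrC ler_pdivrMr // -mulrA -expr2.
move: w2; rewrite ltr_pdivlMr; last by lra.
nra.
Qed.

End ComplexExponential.

(** * Entire functions *)

Section Entire.
Variable R : realType.
Local Notation C := R[i]^o.
Implicit Types f g : C -> C.

Lemma entire_continuous f : entire f -> continuous f.
Proof. by move=> ef z; apply/differentiable_continuous/derivable1_diffP. Qed.

Lemma entire_comp f g : entire f -> entire g -> entire (f \o g).
Proof.
move=> ef eg z; apply/derivable1_diffP.
apply: differentiable_comp; exact/derivable1_diffP.
Qed.

Lemma entire_cst (c : C) : entire (fun _ => c).
Proof. by move=> z; exact: derivable_cst. Qed.

Lemma entire_id : entire (fun z : C => z).
Proof. by move=> z; exact: derivable_id. Qed.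

Lemma entireD f g : entire f -> entire g -> entire (fun z => f z + g z).
Proof. by move=> ef eg z; exact: derivableD. Qed.

Lemma entireN f : entire f -> entire (fun z => - f z).
Proof. by move=> ef z; exact: derivableN. Qed.

Lemma entireM f g : entire f -> entire g -> entire (fun z => f z * g z).
Proof. by move=> ef eg z; exact: derivableM. Qed.

Lemma entireX f n : entire f -> entire (fun z => f z ^+ n).
Proof.
move=> ef; elim: n => [|n IHn]; first exact: entire_cst.
by move=> z; rewrite (_ : (fun _ => _) = (fun z => f z * f z ^+ n)); [exact: entireM|
  apply/funext => w; rewrite exprS].
Qed.
End Entire.

(** * The two functions and their local behaviour *)

Section Functions.
Variable R : realType.
Local Notation C := R[i]^o.
Local Notation Re := (@complex.Re R).
Local Notation Im := (@complex.Im R).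
Implicit Types (s w z : R[i]).

(** The points 2 pi i k are critical points of drift and fixed by it. *)
Definition drift (s : C) : C := s + 1 - cexp s.
Definition ccosh (s : C) : C := (cexp s + cexp (- s)) / 2.

(** The cubic with swing 1 = 0, swing 0 = 1, swing (-1) = -1 and with a critical
    point at 0; at 1 and -1 it is ccosh that is critical. *)
Definition swing (c : C) : C := 1 - 3 / 2 * c ^+ 2 + c ^+ 3 / 2.

(** The function ccosh (s / 4) has period 8 pi i and takes the values 1, 0, -1 at
    0, 2 pi i, 4 pi i. Hence this map fixes 8 pi i k, exchanges 2 pi i with
    4 pi i, and is critical at all these points. *)
Definition swapping (s : C) : C :=
  drift s + (0 +i* (2 * pi)) * swing (ccosh (s / 4)).

(** The exponential factor is flat at the points 2 pi i k, so that drift is just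
    doubled there. On the lines Im s = (2k+1) pi, where ccosh is real and at most
    -1, its modulus is exp (- Im s * (1 - ccosh s)), tiny when Im s is large. *)
Definition doubling (s : C) : C :=
  2 * drift s * cexp ('i * s * (1 - ccosh s)).

Lemma entire_drift : entire drift.
Proof.
apply: entireD; last exact/entireN/entire_cexp.
by apply: entireD; [exact: entire_id|exact: entire_cst].
Qed.

Lemma entire_ccosh : entire ccosh.
Proof.
apply: entireM; last exact: entire_cst.
apply: entireD; first exact: entire_cexp.
apply: (entire_comp (@entire_cexp R)); exact/entireN/entire_id.
Qed.

Lemma entire_doubling : entire doubling.
Proof.
apply: entireM.
  by apply: entireM; [exact: entire_cst|exact: entire_drift].
apply: (entire_comp (@entire_cexp R)); apply: entireM.
  by apply: entireM; [exact: entire_cst|exact: entire_id].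
by apply: entireD; [exact: entire_cst|exact/entireN/entire_ccosh].
Qed.

Lemma entire_swapping : entire swapping.
Proof.
apply: entireD; first exact: entire_drift.
apply: entireM; first exact: entire_cst.
apply: (@entire_comp _ swing (fun s => ccosh (s / 4))); last first.
  apply: (entire_comp entire_ccosh).
  by apply: entireM; [exact: entire_id|exact: entire_cst].
apply: entireD.
  apply: entireD; first exact: entire_cst.
  apply: entireN; apply: entireM; first exact: entire_cst.
  exact/entireX/entire_id.
apply: entireM; last exact: entire_cst.
exact/entireX/entire_id.
Qed.

Lemma normcX z n : normc (z ^+ n) = normc z ^+ n.
Proof. by elim: n => [|n IHn]; rewrite ?expr0 ?normc1 // !exprS normcM IHn. Qed.

Lemma cexp_shift s w : cexp s = 1 -> cexp (s + w) = cexp w.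
Proof. by rewrite cexpD => ->; rewrite mul1r. Qed.

Lemma drift_site s w : cexp s = 1 -> drift (s + w) = s - (cexp w - 1 - w).
Proof. by move=> s1; rewrite /drift cexp_shift //; ring. Qed.

Lemma ccosh_site s w : cexp s = 1 -> ccosh (s + w) = ccosh w.
Proof.
by move=> s1; rewrite /ccosh opprD !cexp_shift // cexpN s1 invr1.
Qed.

Lemma ccosh_sub1 w : normc w <= 1 / 2 -> normc (ccosh w - 1) <= 3 * normc w ^+ 2.
Proof.
move=> w12.
have -> : ccosh w - 1 = ((cexp w - 1 - w) + (cexp (- w) - 1 - (- w))) / 2.
  by rewrite /ccosh; field.
have := cexp_remainder w12; have := @cexp_remainder R (- w); rewrite normcN => /(_ w12).
have := le_normcD (cexp w - 1 - w) (cexp (- w) - 1 - (- w)).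
rewrite normcM normcV normc_nat; lra.
Qed.

Lemma csinh_bound w : normc w <= 1 / 2 ->
  normc ((cexp w - cexp (- w)) / 2) <= 5 / 2 * normc w.
Proof.
move=> w12.
have -> : (cexp w - cexp (- w)) / 2 =
  w + ((cexp w - 1 - w) - (cexp (- w) - 1 - (- w))) / 2 by field.
have := cexp_remainder w12; have := @cexp_remainder R (- w); rewrite normcN => /(_ w12).
have := le_normcD w (((cexp w - 1 - w) - (cexp (- w) - 1 - (- w))) / 2).
have := le_normcD (cexp w - 1 - w) (- (cexp (- w) - 1 - (- w))).
rewrite normcM normcV normc_nat normcN; have := normc_ge0 w; nra.
Qed.

Lemma cexp_sub1 w : normc w <= 1 / 2 -> normc (cexp w - 1) <= 5 / 2 * normc w.
Proof.
move=> w12; have -> : cexp w - 1 = (cexp w - 1 - w) + w by ring.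
have := cexp_remainder w12; have := le_normcD (cexp w - 1 - w) w.
have := normc_ge0 w; nra.
Qed.

Lemma doubling_site_quad s w : cexp s = 1 -> normc w <= 1 / 2 ->
  3 * (normc s + 1) * normc w ^+ 2 <= 1 / 2 ->
  normc (doubling (s + w) - 2 * s) <=
    15 * normc s * (normc s + 1) * normc w ^+ 2 + 14 * normc w ^+ 2.
Proof.
move=> s1 w12 sw; rewrite /doubling drift_site // ccosh_site //.
set e2 := cexp w - 1 - w; set q := 'i * (s + w) * (1 - ccosh w).
have e2b : normc e2 <= 3 * normc w ^+ 2 by exact: cexp_remainder.
have qb : normc q <= (normc s + 1) * (3 * normc w ^+ 2).
  rewrite /q normcM; apply: ler_pM; rewrite ?normc_ge0 //.
    rewrite normcM normc_im normr1 mul1r; apply: le_trans (le_normcD _ _) _.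
    by rewrite lerD2l; lra.
  by rewrite normcB; exact: ccosh_sub1.
have q12 : normc q <= 1 / 2 by apply: le_trans qb _; lra.
have eq1 := cexp_sub1 q12.
have eq2 : normc (cexp q) <= 9 / 4.
  rewrite -[cexp q](subrK 1); apply: le_trans (le_normcD _ _) _.
  rewrite normc1; lra.
have -> : 2 * (s - e2) * cexp q - 2 * s = 2 * (s * (cexp q - 1)) - 2 * (e2 * cexp q).
  by ring.
apply: le_trans (le_normcD _ _) _; rewrite normcN !normcM normc_nat.
have s0 := normc_ge0 s; have w0 := normc_ge0 w; have e0 := normc_ge0 e2.
have A : normc s * normc (cexp q - 1) <=
    normc s * (5 / 2 * ((normc s + 1) * (3 * normc w ^+ 2))).
  by apply: ler_wpM2l => //; lra.
have B : normc e2 * normc (cexp q) <= (3 * normc w ^+ 2) * (9 / 4).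
  by apply: ler_pM => //; exact: normc_ge0.
have := sqr_ge0 (normc w); lra.
Qed.

(** The quadratic error grows like the square of |s|, which the radius absorbs. *)
Lemma doubling_site s w : cexp s = 1 -> 4 <= normc s ->
  normc w <= 1 / (100 * normc s ^+ 2) ->
  normc (doubling (s + w) - 2 * s) <= normc w / 4.
Proof.
move=> s1 s4; rewrite ler_pdivlMr; last by nra.
set Y := normc s in s4 *; set t := normc w => tY.
have t0 : 0 <= t := normc_ge0 w.
have u1 : t * Y <= 1 / 400 by nra.
have u2 : t <= 1 / 1600 by nra.
have u3 : t * (Y + 1) <= 1 / 100 by nra.
have u4 : t * Y * (Y + 1) <= 5 / 400 by nra.
apply: le_trans (doubling_site_quad s1 _ _) _; rewrite -/Y -/t; first by lra.
  nra.
nra.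
Qed.

Lemma doubling_near0 w : normc w <= 1 / 18 -> normc (doubling w) <= normc w.
Proof.
move=> w18; have w0 := normc_ge0 w.
have := @doubling_site_quad 0 w (cexp0 R); rewrite add0r mulr0 subr0 normc0 => H.
apply: le_trans (H _ _) _; [by lra|nra|nra].
Qed.

(** This bound and the next two are read off factorizations: swing vanishes to
    first order at 1, swing - 1 to second order at 0, swing + 1 to first order at
    -1; at 1 and -1 the second order comes from ccosh. *)
Lemma normc_swing1 c : normc (c - 1) <= 1 / 8 -> normc (swing c) <= 2 * normc (c - 1).
Proof.
move=> c8; have -> : swing c = (c - 1) * ((c - 1) ^+ 2 / 2 - 3 / 2).
  by rewrite /swing; field.
rewrite normcM mulrC; apply: ler_wpM2r; first exact: normc_ge0.
apply: le_trans (le_normcD _ _) _; rewrite normcN !normcM !normcV !normc_nat.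
have := normc_ge0 (c - 1); nra.
Qed.

Lemma normc_swing0 c : normc c <= 1 / 8 -> normc (swing c - 1) <= 2 * normc c ^+ 2.
Proof.
move=> c8; have -> : swing c - 1 = c ^+ 2 * (c / 2 - 3 / 2) by rewrite /swing; field.
rewrite normcM normcX mulrC; apply: ler_wpM2r; first exact: sqr_ge0.
apply: le_trans (le_normcD _ _) _; rewrite normcN !normcM !normcV !normc_nat; lra.
Qed.

Lemma normc_swingN1 c : normc (c + 1) <= 1 / 8 ->
  normc (swing c + 1) <= 5 * normc (c + 1).
Proof.
move=> c8; have -> : swing c + 1 = (c + 1) * (9 / 2 - (c + 1) * 3 + (c + 1) ^+ 2 / 2).
  by rewrite /swing; field.
rewrite normcM mulrC; apply: ler_wpM2r; first exact: normc_ge0.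
apply: le_trans (le_normcD _ _) _.
have := le_normcD (9 / 2) (- ((c + 1) * 3)).
rewrite normcN !normcM !normcV !normc_nat.
have := normc_ge0 (c + 1); nra.
Qed.

Lemma pi_lt4 : pi < 4 :> R.
Proof. have := pihalf_lt2 R; lra. Qed.

Lemma swapping_site_bound s w (c : R[i]) k : cexp s = 1 -> normc w <= 1 / 2 ->
  normc (swing (ccosh ((s + w) / 4)) - c) <= k ->
  normc (swapping (s + w) - (s + (0 +i* (2 * pi)) * c)) <= 3 * normc w ^+ 2 + 8 * k.
Proof.
move=> s1 w12 ck; rewrite /swapping drift_site //.
set t := swing _ in ck *; set p := 0 +i* _.
have -> : s - (cexp w - 1 - w) + p * t - (s + p * c) = p * (t - c) - (cexp w - 1 - w).
  by ring.
apply: le_trans (le_normcD _ _) _; rewrite normcN normcM addrC.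
apply: lerD; first exact: cexp_remainder.
apply: ler_pM; rewrite ?normc_ge0 // normc_im ger0_norm.
  by have := pi_lt4; lra.
by have := pi_ge0 R; lra.
Qed.

Lemma swapping_site_fixed s w : cexp s = 1 -> cexp (s / 4) = 1 -> normc w <= 1 / 24 ->
  normc (swapping (s + w) - s) <= normc w / 4.
Proof.
move=> s1 s4 w24; have w0 := normc_ge0 w.
have u4 : normc (w / 4) = normc w / 4 by rewrite normcM normcV normc_nat.
have c1 : normc (ccosh (w / 4) - 1) <= 3 * (normc w / 4) ^+ 2.
  by rewrite -u4; apply: ccosh_sub1; rewrite u4; lra.
have sw : normc (swing (ccosh ((s + w) / 4)) - 0) <= 2 * (3 * (normc w / 4) ^+ 2).
  rewrite subr0 mulrDl ccosh_site //; apply: le_trans (normc_swing1 _) _; nra.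
have := swapping_site_bound s1 _ sw; rewrite mulr0 addr0 => /(_ ltac:(lra)); nra.
Qed.

Lemma swapping_site_up s w : cexp s = 1 -> cexp (s / 4) = 'i -> normc w <= 1 / 50 ->
  normc (swapping (s + w) - (s + (0 +i* (2 * pi)))) <= normc w / 4.
Proof.
move=> s1 s4 w50; have w0 := normc_ge0 w.
have u4 : normc (w / 4) = normc w / 4 by rewrite normcM normcV normc_nat.
have -> : s + (0 +i* (2 * pi)) = s + (0 +i* (2 * pi)) * 1 by rewrite mulr1.
have c1 : normc (ccosh ((s + w) / 4)) <= 5 / 2 * (normc w / 4).
  have -> : ccosh ((s + w) / 4) = 'i * ((cexp (w / 4) - cexp (- (w / 4))) / 2).
    rewrite /ccosh (mulrDl s w) opprD !cexpD (cexpN (s / 4)) s4.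
    have i0 : 'i != 0 :> R[i] by rewrite eq_complex /= oner_eq0 andbF.
    have -> : 'i^-1 = - 'i :> R[i].
      by apply: (mulfI i0); rewrite mulfV // mulrN -expr2 sqr_i opprK.
    by rewrite mulNr -mulrBr mulrA.
  rewrite normcM normc_im normr1 mul1r -u4; apply: csinh_bound; rewrite u4; lra.
have c0 := normc_ge0 (ccosh ((s + w) / 4)).
have sw : normc (swing (ccosh ((s + w) / 4)) - 1) <= 2 * (5 / 2 * (normc w / 4)) ^+ 2.
  apply: le_trans (normc_swing0 _) _; nra.
have := swapping_site_bound s1 _ sw => /(_ ltac:(lra)); nra.
Qed.

Lemma swapping_site_down s w : cexp s = 1 -> cexp (s / 4) = -1 -> normc w <= 1 / 50 ->
  normc (swapping (s + w) - (s - (0 +i* (2 * pi)))) <= normc w / 4.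
Proof.
move=> s1 s4 w50; have w0 := normc_ge0 w.
have u4 : normc (w / 4) = normc w / 4 by rewrite normcM normcV normc_nat.
have -> : s - (0 +i* (2 * pi)) = s + (0 +i* (2 * pi)) * (-1) by rewrite mulrN1.
have c1 : normc (ccosh ((s + w) / 4) + 1) <= 3 * (normc w / 4) ^+ 2.
  have -> : ccosh ((s + w) / 4) + 1 = - (ccosh (w / 4) - 1).
    rewrite /ccosh (mulrDl s w) opprD !cexpD (cexpN (s / 4)) s4 invrN1.
    by field.
  by rewrite normcN -u4; apply: ccosh_sub1; rewrite u4; lra.
have sw : normc (swing (ccosh ((s + w) / 4)) - (-1)) <= 5 * (3 * (normc w / 4) ^+ 2).
  rewrite opprK; apply: le_trans (normc_swingN1 _) _; nra.
have := swapping_site_bound s1 _ sw => /(_ ltac:(lra)); nra.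
Qed.

(** Here cexp s = - exp x and ccosh s = - H with H = cosh x. The factor
    exp (- y H) beats the linear growth of drift, and exp (- y) with y >= 10
    leaves a small constant. *)
Lemma doubling_barrier (x y : R) : cos y = -1 -> sin y = 0 -> 10 <= y ->
  normc (doubling (x +i* y)) <= 1 / 24.
Proof.
move=> cy sy y10.
pose H := (expR x + expR (- x)) / 2.
have ex0 := expR_gt0 x; have exN0 := expR_gt0 (- x).
have e1 := expR_ge1Dx x; have e2 := expR_ge1Dx (- x).
have H1 : 1 <= H by rewrite /H; lra.
have es : cexp (x +i* y) = - (expR x)%:C.
  by rewrite /cexp /= cy sy mulrN1 mulr0; simpc.
have eNs : cexp (- (x +i* y)) = - (expR (- x))%:C.
  by rewrite /cexp /= cosN sinN cy sy mulrN1 oppr0 mulr0; simpc.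
have cs : ccosh (x +i* y) = - H%:C.
  by rewrite /ccosh es eNs -opprD -rmorphD mulNr /H rmorphM fmorphV rmorph_nat.
rewrite /doubling cs opprK (normcM (2 * _)) (normcM 2) normc_nat normc_cexp.
have -> : complex.Re ('i * (x +i* y) * (1 + H%:C)) = - (y * (1 + H)).
  by simpc => /=; ring.
have dr : normc (drift (x +i* y)) <= y + 4 * H.
  rewrite /drift es opprK; apply: le_trans (le_normcD _ _) _.
  rewrite normc_real gtr0_norm //.
  have := le_normcD (x +i* y) 1; rewrite normc1; have := @normc_le_ReIm R (x +i* y).
  rewrite /= (@ger0_norm _ y); last by lra.
  have : `|x| <= 2 * H - 1 by rewrite /H ler_norml; apply/andP; split; lra.
  have : expR x <= 2 * H by rewrite /H; lra.
  lra.
have E1 : expR (- y) <= 1 / 167.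
  rewrite expRN -[leLHS]div1r ler_pdivrMr ?expR_gt0 //.
  have y0 : 0 <= y by lra.
  have := expR_ge1Dxn 2 y0; have -> : 3`!%:R = 6 :> R by [].
  have : 1000 <= y ^+ 3 by rewrite !exprS expr0; nra.
  lra.
have E2 : expR (- (y * H)) * (1 + y * H) <= 1.
  rewrite -[leRHS](expRxMexpNx_1 (y * H)) mulrC ler_pM2r ?expR_gt0 //.
  exact: expR_ge1Dx.
have -> : - (y * (1 + H)) = - (y * H) + - y by ring.
rewrite expRD.
have D0 := normc_ge0 (drift (x +i* y)).
have f0 := expR_gt0 (- (y * H)); have g0 := expR_gt0 (- y).
have dr2 : normc (drift (x +i* y)) <= 2 * (1 + y * H) by nra.
have P1 : normc (drift (x +i* y)) * expR (- (y * H)) <= 2.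
  apply: (@le_trans _ _ (2 * (1 + y * H) * expR (- (y * H)))).
    by rewrite ler_pM2r.
  lra.
rewrite mulrA -(mulrA 2); nra.
Qed.

Lemma cexp_im (y : R) : cexp (0 +i* y) = cos y +i* sin y.
Proof. by rewrite /cexp /= expR0 !mul1r. Qed.

Lemma cexp_mulrn z n : cexp (z *+ n) = cexp z ^+ n.
Proof. by elim: n => [|n IHn]; rewrite ?mulr0n ?cexp0 // mulrS cexpD IHn exprS. Qed.

Lemma im_mulrn (y : R) n : (0 +i* y) *+ n = 0 +i* (y *+ n).
Proof. by elim: n => [|n IHn]; rewrite ?mulr0n // !mulrS IHn; simpc. Qed.

Lemma cexp_2pi n : cexp (0 +i* (2 * pi *+ n)) = 1 :> R[i].
Proof.
rewrite -im_mulrn cexp_mulrn cexp_im mulr_natl cos2pi sin2pi.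
by rewrite -[1 +i* 0]/(1 : R[i]) expr1n.
Qed.

End Functions.

(** * Transport of the discs *)

Section Assembly.
Variable R : realType.
Local Notation C := R[i]^o.
Local Notation Re := (@complex.Re R).
Local Notation Im := (@complex.Im R).
Implicit Types (w z : R[i]).

(** Chosen so that site n is the n-th iterate of site 0 under the doubling map. *)
Definition height (n : nat) : R := 4 * pi * 2 ^+ n.
Definition site (n : nat) : C := 0 +i* height n.

(** Proportional to the inverse square of the height, as the second order
    estimate at a site requires; it is divided by 4 from one site to the next,
    which is exactly the contraction that the maps provide. *)
Definition radius (n : nat) : R := 1 / (100 * height n ^+ 2).

(** The swapping map exchanges it with site 0, and the doubling map sends it to
    site 0 as well. *)
Definition companion : C := 0 +i* (2 * pi).

Lemma height_ge n : 2 ^+ n <= height n.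
Proof. by rewrite /height ler_peMl ?exprn_ge0 //; have := pi_ge2 R; lra. Qed.

Lemma height_ge8 n : 8 <= height n.
Proof.
have := pi_ge2 R; have : 1 <= 2 ^+ n :> R by rewrite exprn_ege1 // ler1n.
rewrite /height; set t := 2 ^+ n; nra.
Qed.

Lemma heightS n : height n.+1 = 2 * height n.
Proof. by rewrite /height exprS; ring. Qed.

Lemma radius_gt0 n : 0 < radius n.
Proof. by have := height_ge8 n => h8; apply: divr_gt0 => //; nra. Qed.

Lemma radiusS n : radius n.+1 = radius n / 4.
Proof.
by have := height_ge8 n => h8; rewrite /radius heightS; field; rewrite gt_eqF //; lra.
Qed.

Lemma radius_le n : radius n <= 1 / 6400.
Proof.
have h8 := height_ge8 n; rewrite /radius ler_pdivrMr; nra.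
Qed.

Lemma normc_site n : normc (site n) = height n.
Proof. by rewrite normc_im ger0_norm //; have := height_ge8 n; lra. Qed.

Lemma siteS n : site n.+1 = 2 * site n.
Proof. by rewrite /site heightS; simpc; congr (_ +i* _); ring. Qed.

Lemma cexp_site n : cexp (site n) = 1.
Proof.
have -> : site n = 0 +i* (2 * pi *+ (2 * 2 ^ n)).
  by rewrite /site /height -(mulr_natr (2 * pi)) natrM natrX; congr (_ +i* _); ring.
exact: cexp_2pi.
Qed.

Lemma im_div4 (y : R) : (0 +i* y) / 4 = 0 +i* (y / 4) :> R[i].
Proof.
have n4 : 4 != 0 :> R[i] by rewrite pnatr_eq0.
apply: (mulIf n4); rewrite mulfVK // mulr_natr im_mulrn.
by congr (_ +i* _); rewrite -mulr_natr; field.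
Qed.

Lemma cexp_siteS_div4 n : cexp (site n.+1 / 4) = 1.
Proof.
have -> : site n.+1 / 4 = 0 +i* (2 * pi *+ (2 ^ n)).
  rewrite /site im_div4 /height exprS -(mulr_natr (2 * pi)) natrX.
  by congr (_ +i* _); field.
exact: cexp_2pi.
Qed.

Lemma cexp_site0_div4 : cexp (site 0 / 4) = -1.
Proof.
rewrite /site im_div4 /height expr0 mulr1.
have -> : 4 * pi / 4 = pi :> R by field.
by rewrite cexp_im cospi sinpi; simpc.
Qed.

Lemma cexp_companion : cexp companion = 1.
Proof. by have := cexp_2pi R 1; rewrite mulr1n. Qed.

Lemma cexp_companion_div4 : cexp (companion / 4) = 'i.
Proof.
rewrite /companion im_div4; have -> : 2 * pi / 4 = pi / 2 :> R by field.
by rewrite cexp_im cos_pihalf sin_pihalf.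
Qed.

Lemma site0E : site 0 = companion + companion.
Proof. by rewrite /site /companion /height expr0; simpc; congr (_ +i* _); ring. Qed.

Lemma doubling_contract n w : normc w <= radius n ->
  normc (doubling (site n + w) - site n.+1) <= normc w / 4.
Proof.
move=> wr; rewrite siteS; apply: doubling_site; rewrite ?normc_site //.
  exact: cexp_site.
by have := height_ge8 n; lra.
Qed.

Lemma doubling_companion w : normc w <= 4 * radius 0 ->
  normc (doubling (companion + w) - site 0) <= normc w / 4.
Proof.
have nc : normc companion = 2 * pi.
  by rewrite normc_im ger0_norm //; have := pi_ge0 R; lra.
move=> wr; have -> : site 0 = 2 * companion by rewrite site0E; ring.
apply: doubling_site; rewrite ?nc; [exact: cexp_companion|by have := pi_ge2 R; lra|].
apply: le_trans wr _; rewrite /radius /height expr0.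
rewrite [leLHS](_ : _ = 1 / (100 * (2 * pi) ^+ 2)) //.
by field; rewrite gt_eqF ?pnatr_eq0 //; have := pi_gt0 R; lra.
Qed.

Lemma swapping_contract n w : normc w <= 1 / 50 ->
  normc (swapping (site n.+1 + w) - site n.+1) <= normc w / 4.
Proof.
move=> w50; apply: swapping_site_fixed; [exact: cexp_site|exact: cexp_siteS_div4|lra].
Qed.

Lemma swapping_site0 w : normc w <= 1 / 50 ->
  normc (swapping (site 0 + w) - companion) <= normc w / 4.
Proof.
move=> w50; have -> : companion = site 0 - companion by rewrite site0E addrK.
exact: swapping_site_down (cexp_site 0) cexp_site0_div4 w50.
Qed.

Lemma swapping_companion w : normc w <= 1 / 50 ->
  normc (swapping (companion + w) - site 0) <= normc w / 4.
Proof.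
rewrite site0E => w50.
exact: swapping_site_up cexp_companion cexp_companion_div4 w50.
Qed.

Lemma swapping_near0 w : normc w <= 1 / 24 -> normc (swapping w) <= normc w.
Proof.
move=> w24; have := @swapping_site_fixed R 0 w (cexp0 R).
by rewrite mul0r add0r subr0 => /(_ (cexp0 R) w24); have := normc_ge0 w; lra.
Qed.

(** An odd multiple of pi between two consecutive heights. *)
Definition cut (n : nat) : R := height n + pi.

Lemma doubling_cut z n : Im z = cut n -> normc (doubling z) <= 1 / 24.
Proof.
case: z => x y; rewrite -[complex.Im _]/y => ->.
have hE : cut n = pi + 2 * pi *+ (2 * 2 ^ n).
  by rewrite /cut /height -(mulr_natr (2 * pi)) natrM natrX; ring.
have h8 := height_ge8 n; have p2 := pi_ge2 R.
apply: doubling_barrier; last by rewrite /cut; lra.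
  rewrite hE mulr_natl; have := periodicn (@cosD2pi R) (2 * 2 ^ n) pi.
  by rewrite cospi.
rewrite hE mulr_natl; have := periodicn (@sinD2pi R) (2 * 2 ^ n) pi.
by rewrite sinpi.
Qed.

Lemma cut_between n : height n < cut n < height n.+1.
Proof.
have p2 := pi_ge2 R; have : 1 <= 2 ^+ n :> R by rewrite exprn_ege1 // ler1n.
rewrite heightS /cut /height; set t := 2 ^+ n => t1.
by apply/andP; split; nra.
Qed.

Lemma trapped_not_escaping (h : C -> C) z (r : R) :
  (forall w, normc w <= r -> normc (h w) <= r) -> normc (h z) <= r ->
  ~ escaping h z.
Proof.
move=> hr hz /(_ r)[N _ HN]; have := HN N.+1 (leqnSn N); rewrite /= ltNge => /negP; apply.
by elim: N {HN} => // n IHn /=; exact: hr.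
Qed.

Lemma doubling_cut_not_escaping n z : Im z = cut n -> ~ escaping (@doubling R) z.
Proof.
move=> /doubling_cut zn; apply: (@trapped_not_escaping _ _ (1 / 24)) => // w w24.
have w18 : normc w <= 1 / 18 by lra.
exact: le_trans (doubling_near0 w18) w24.
Qed.

(** The doubling map sends the line into a disc about 0 that both maps preserve. *)
Lemma comp_cut_not_escaping n z : Im z = cut n ->
  ~ escaping (@swapping R \o @doubling R) z.
Proof.
have step w : normc (doubling w) <= 1 / 24 ->
    normc ((@swapping R \o @doubling R) w) <= 1 / 24.
  by move=> gw; apply: le_trans (swapping_near0 gw) gw.
move=> /doubling_cut /step zn; apply: (@trapped_not_escaping _ _ (1 / 24)) => // w w24.
apply: step.
have w18 : normc w <= 1 / 18 by lra.
exact: le_trans (doubling_near0 w18) w24.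
Qed.

Lemma disc_lies_in (h : C -> C) (P : set C -> Prop) z r : 0 < r ->
  disc z r `<=` fatou h -> P (connected_component (fatou h) z) ->
  lies_in (disc z r) P.
Proof.
move=> r0 sF Pz; exists (connected_component (fatou h) z) => //.
apply: connected_component_max => //; first exact: disc_center.
exact: disc_connected.
Qed.

Lemma attracting_disc (h : C -> C) q p r : entire h -> (0 < q)%N -> 0 < r ->
  (forall w, normc w < r -> normc (iter q h (p + w) - p) <= normc w / 4) ->
  lies_in (disc p r) (periodic_component h).
Proof.
move=> eh q0 r0 hq.
have hp : iter q h p = p.
  have := hq 0; rewrite normc0 mul0r addr0 => /(_ r0) h0.
  exact: normc_sub_le0 h0.
have ch := entire_continuous eh.
have contr w : normc (w - p) < r -> normc (iter q h w - p) <= normc (w - p) / 2.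
  by move=> /hq; rewrite (addrC p) subrK; have := normc_ge0 (w - p); lra.
apply: (@disc_lies_in h _ p r r0).
  by move=> w wr; apply: (basin_fatou ch q0 contr); exists 0%N.
exact: attracting_periodic_component ch q0 r0 hp contr.
Qed.

(** Discs about the sites are sent into one another, so they escape uniformly,
    and the horizontal lines at the heights cut n keep them in distinct
    components. *)
Lemma wandering_disc (h : C -> C) :
  (forall n w, normc w <= radius n -> normc (h (site n + w) - site n.+1) <= normc w / 4) ->
  (forall n z, Im z = cut n -> ~ escaping h z) ->
  lies_in (disc (site 0) (radius 0)) (wandering_component h).
Proof.
move=> hs hcut.
have orbit n w : disc (site 0) (radius 0) w ->
    normc (iter n h w - site n) < radius n.
  move=> wD; elim: n => // n IHn; rewrite radiusS /=.
  have := hs n (iter n h w - site n) (ltW IHn).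
  by rewrite (addrC (site n)) subrK; lra.
have orbit0 n : iter n h (site 0) = site n.
  elim: n => //= n ->; have := hs n 0; rewrite normc0 mul0r addr0.
  move=> /(_ (ltW (radius_gt0 n))) h0.
  exact: normc_sub_le0 h0.
have D0 : disc (site 0) (radius 0) (site 0) by exact/disc_center/radius_gt0.
have esc M : \forall n \near \oo, forall w, disc (site 0) (radius 0) w ->
    M < normc (iter n h w).
  near=> n => w wD.
  have := le_normcD (site n - iter n h w) (iter n h w).
  rewrite subrK normc_site (normcB (site n)).
  have := orbit n w wD; have := radius_le n; have := height_ge n.
  have : M + 1 < 2 ^+ n.
    apply: (@lt_le_trans _ _ n%:R).
      by near: n; exact: nbhs_infty_gtr.
    by rewrite -natrX ler_nat ltnW // ltn_expl.
  lra.
have sF : disc (site 0) (radius 0) `<=` fatou h.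
  move=> w wD; exists (disc (site 0) (radius 0)).
    by split=> //; exact: disc_open.
  exact: uniform_escaping_normal.
apply: (@disc_lies_in h) => //; first exact: radius_gt0.
apply: (@wandering_of_barrier _ h (site 0) cut) => //.
- exact: sF.
- by move=> M; apply: filterS (esc M) => n; exact.
- by move=> k; rewrite !orbit0; exact: cut_between.
Unshelve. all: by end_near. Qed.


Lemma poly_eq_on_sequence (p q : {poly R[i]}) (u : nat -> R[i]) :
  injective u -> (forall n, p.[u n] = q.[u n]) -> p = q.
Proof.
move=> uI pq; apply/eqP; rewrite -subr_eq0; apply/negPn/negP => pq0.
have := max_poly_roots pq0 (rs := map u (iota 0 (size (p - q)))).
rewrite size_map size_iota ltnn map_inj_uniq ?iota_uniq // => H.
suff : false by []. apply: H => //; apply/allP => _ /mapP[n _ ->].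
by rewrite /root hornerD hornerN pq subrr.
Qed.

Lemma site_inj : injective site.
Proof.
move=> m n [] hmn; have p0 : 4 * pi != 0 :> R.
  by rewrite gt_eqF // mulr_gt0 // pi_gt0.
apply: (@ieexprIn _ (2 : R)); [by []|by rewrite pnatr_eq1|exact: (mulfI p0)].
Qed.

Lemma swapping_site n : swapping (site n.+1) = site n.+1.
Proof.
have := @swapping_contract n 0; rewrite normc0 mul0r addr0 => /(_ ltac:(lra)) h0.
exact: normc_sub_le0 h0.
Qed.

Lemma doubling_siteE n : doubling (site n) = site n.+1.
Proof.
have := @doubling_contract n 0; rewrite normc0 mul0r addr0 => /(_ (ltW (radius_gt0 n))) h0.
exact: normc_sub_le0 h0.
Qed.

(** A polynomial that agreed with the map would be 'X, as it fixes infinitely many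
    sites; but site 0 is moved. *)
Lemma transcendental_swapping : transcendental_entire (@swapping R).
Proof.
split=> [|[p fp]]; first exact: entire_swapping.
have pX : p = 'X.
  apply: (@poly_eq_on_sequence _ _ (fun n => site n.+1)).
    by move=> m n /site_inj[].
  by move=> n; rewrite hornerX -fp swapping_site.
have := swapping_site0 (w := 0); rewrite normc0 mul0r addr0 fp pX hornerX => /(_ ltac:(lra)).
rewrite site0E addrK normc_im ger0_norm; have := pi_gt0 R; lra.
Qed.

(** A polynomial that agreed with the map would be 2 'X, as it doubles all sites;
    but on the cuts the map is small. *)
Lemma transcendental_doubling : transcendental_entire (@doubling R).
Proof.
split=> [|[p gp]]; first exact: entire_doubling.
have pX : p = 2 *: 'X.
  apply: (@poly_eq_on_sequence _ _ site); first exact: site_inj.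
  by move=> n; rewrite hornerZ hornerX -gp doubling_siteE siteS.
have := @doubling_cut (0 +i* cut 0) 0 erefl.
rewrite gp pX hornerZ hornerX normcM normc_nat normc_im.
have /andP[+ _] := cut_between 0; have := height_ge8 0.
have := ler_norm (cut 0); lra.
Qed.

End Assembly.

Theorem theorem2p11 (R : realType) :
  exists f g : R[i]^o -> R[i]^o,
    [/\ transcendental_entire f,
        transcendental_entire g &
        exists D : set R[i]^o,
          is_domain D /\
          [/\ lies_in D (periodic_component f),
              lies_in D (wandering_component g),
              lies_in D (preperiodic_component (g \o f)) &
              lies_in D (wandering_component (f \o g))]].
Proof.
have r0 := radius_gt0 R 0; have r1 := radius_le R 0.
exists (@swapping R), (@doubling R); split;
  [exact: transcendental_swapping|exact: transcendental_doubling|].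
exists (disc (site R 0) (radius R 0)); split.
  split; [by exists (site R 0); exact: disc_center|exact: disc_open|exact: disc_connected].
split.
- apply: (@attracting_disc R _ 2); [exact: entire_swapping|by []|by []|move=> w wr /=].
  have h1 := @swapping_site0 R w ltac:(lra).
  have := @swapping_companion R (swapping (site R 0 + w) - companion R).
  rewrite (addrC (companion R)) subrK => h2; have := normc_ge0 w => w0.
  by apply: le_trans (h2 _) _; lra.
- apply: wandering_disc; [exact: doubling_contract|exact: doubling_cut_not_escaping].
(* The swapping map sends the disc to the companion, the doubling map brings it
   back. *)
- suff [U pU DU] : lies_in (disc (site R 0) (radius R 0))
      (periodic_component (@doubling R \o @swapping R)).
    by exists U => //; exact: periodic_preperiodic.
  apply: (@attracting_disc R _ 1); [|by []|by []|move=> w wr /=].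
    exact: entire_comp (@entire_doubling R) (@entire_swapping R).
  have h1 := @swapping_site0 R w ltac:(lra).
  have := @doubling_companion R (swapping (site R 0 + w) - companion R).
  rewrite (addrC (companion R)) subrK => h2; have := normc_ge0 w => w0.
  by apply: le_trans (h2 _) _; lra.
- apply: wandering_disc; last exact: comp_cut_not_escaping.
  move=> n w wr /=; have h1 := doubling_contract wr.
  have := @swapping_contract R n (doubling (site R n + w) - site R n.+1).
  rewrite (addrC (site R n.+1)) subrK => h2; have := normc_ge0 w => w0.
  have rn := radius_le R n; by apply: le_trans (h2 _) _; lra.
Qed.
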